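(* Let $b\in L^1_{loc}(\mathbb{R}^n)$, and let $T$ be a bilinear operator defined on $L^{p_1}\times L^{p_2}$ which can be represented as $$T(f,g)(x)=\int K(x-y,x-z)f(y)g(z)\,dy\,dz\qquad\text{for all } x\notin \operatorname{supp}(f)\cap\operatorname{supp}(g),$$ where $K$ is a homogeneous kernel of degree $-2n+\alpha$, and such that on some ball $B\subset\mathbb{R}^{2n}$ the Fourier series of $\frac1K$ is absolutely convergent. Then, for $$1>\frac1q=\frac1{p_1}+\frac1{p_2}-\frac{\alpha}{n}$$ and for $j=1$ or $2$, $$[b,T]_j:L^{p_1}\times L^{p_2}\to L^q\quad\Longrightarrow\quad b\in BMO(\mathbb{R}^n).$$
   Context: All function spaces are over $\mathbb{R}^n$, and $\alpha$ is a real number. BMO: $BMO(\mathbb{R}^n)$ consists of all locally integrable functions $b$ such that $\|b\|_*:=\sup_Q \frac1{|Q|}\int_Q|b(x)-b_Q|\,dx<\infty$, where $Q$ is a cube with sides parallel to the axes and $b_Q$ is the average of $b$ over $Q$. Commutators: for a locally integrable function $b$ and a bilinear operator $T$, $$[b,T]_1(f,g)(x):=b(x)T(f,g)(x)-T(bf,g)(x),\qquad [b,T]_2(f,g)(x):=b(x)T(f,g)(x)-T(f,bg)(x).$$ The notation $[b,T]_j:L^{p_1}\times L^{p_2}\to L^q$ means that the commutator $[b,T]_j$ is bounded from $L^{p_1}\times L^{p_2}$ to $L^q$. Only the commutator is assumed bounded, not the underlying operator $T$. Homogeneous of degree $-2n+\alpha$: $K(\lambda y,\lambda z)=\lambda^{-2n+\alpha}K(y,z)$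 for $\lambda>0$ and $(y,z)\in\mathbb{R}^n\times\mathbb{R}^n$, $(y,z)\neq 0$. Absolutely convergent Fourier series of $\frac1K$ on $B$: on $B$ one can write $\frac1{K(y,z)}=\sum_k a_k e^{i\nu_k\cdot(y,z)}$ with coefficients satisfying $\sum_k|a_k|<\infty$ and vectors $\nu_k\in\mathbb{R}^{2n}$ (the specific vectors play no role). *)

(* Defs.v *)
From HB Require Import structures.
From mathcomp Require Import all_boot all_order all_algebra.
From mathcomp Require Import all_classical all_reals all_analysis.
From mathcomp Require Import complex.

Set Implicit Arguments.
Unset Strict Implicit.
Unset Printing Implicit Defensive.

Import Order.TTheory GRing.Theory Num.Theory.
Import numFieldNormedType.Exports.

Local Open Scope classical_set_scope.
Local Open Scope ring_scope.

Definition measure_row_display : measure_display -> measure_display.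
Proof. exact. Qed.

(* The product sigma-algebra on row vectors; for the reals these are the Borel
   sets of R^n. *)
Section measurable_row.
Context {d : measure_display} {T : measurableType d}.
Variable n : nat.

Let coor : 'I_n -> 'rV[T]_n -> T := fun i x => x ord0 i.

Let row_set0 : g_sigma_preimage coor set0.
Proof. exact: sigma_algebra0. Qed.

Let row_setC A : g_sigma_preimage coor A -> g_sigma_preimage coor (~` A).
Proof. exact: sigma_algebraC. Qed.

Let row_bigcup (F : (set 'rV[T]_n)^nat) :
  (forall i, g_sigma_preimage coor (F i)) ->
  g_sigma_preimage coor (\bigcup_i (F i)).
Proof. exact: sigma_algebra_bigcup. Qed.

HB.instance Definition _ := @isMeasurable.Build (measure_row_display d)
  'rV[T]_n (g_sigma_preimage coor) row_set0 row_setC row_bigcup.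

End measurable_row.

Lemma measurable_coor (d : measure_display) (T : measurableType d) (n : nat)
    (i : 'I_n) :
  measurable_fun [set: 'rV[T]_n] (fun x : 'rV[T]_n => x ord0 i).
Proof.
move=> _ Y mY; rewrite setTI; apply: sub_sigma_algebra => /=.
rewrite -bigcup_seq/=; exists i => /=; first by rewrite mem_index_enum.
by exists Y => //; rewrite setTI.
Qed.

Lemma measurable_fun_rowP (d1 d2 : measure_display) (T1 : measurableType d1)
    (T2 : measurableType d2) (n : nat) (f : T1 -> 'rV[T2]_n) :
  measurable_fun [set: T1] f <->
  forall i, measurable_fun [set: T1] (fun x => f x ord0 i).
Proof.
split=> [mf i|mf].
  exact: (measurableT_comp (@measurable_coor _ T2 n i) mf).
move=> _ A mA; rewrite setTI; move: A mA.
have sF : sigma_algebra setT [set A | measurable (f @^-1` A)].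
  split => /=; first by rewrite preimage_set0.
  - by move=> A mA; rewrite setTD preimage_setC; exact: measurableC.
  - by move=> F mF; rewrite preimage_bigcup; exact: bigcupT_measurable.
apply: smallest_sub => // A.
rewrite -bigcup_seq/= => -[i _ [B mB <-]].
by rewrite setTI /= -comp_preimage -[X in measurable X]setTI; exact: mf.
Qed.

Section lebesgue_row.
Variable R : realType.

Definition row_cons (n : nat) (z : measurableTypeR R * 'rV[R]_n) : 'rV[R]_n.+1 :=
  \row_(i < n.+1) oapp (z.2 ord0) z.1 (unlift ord0 i).

Definition row_uncons (n : nat) (x : 'rV[R]_n.+1) : measurableTypeR R * 'rV[R]_n :=
  (x ord0 ord0, \row_(i < n) x ord0 (lift ord0 i)).

Lemma row_consK (n : nat) : cancel (@row_cons n) (@row_uncons n).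
Proof.
move=> [a v]; rewrite /row_uncons; congr pair.
  by rewrite mxE unlift_none.
by apply/rowP => i; rewrite !mxE liftK.
Qed.

Lemma measurable_row_cons (n : nat) : measurable_fun setT (@row_cons n).
Proof.
apply/measurable_fun_rowP => i; case: (unliftP ord0 i) => [j|] ->.
  rewrite (_ : (fun _ => _) = (fun v : 'rV[R]_n => v ord0 j) \o snd).
    exact: measurableT_comp (measurable_coor _) measurable_snd.
  by apply/funext => z /=; rewrite mxE liftK.
rewrite (_ : (fun _ => _) = fst) //.
by apply/funext => z /=; rewrite mxE unlift_none.
Qed.

Lemma measurable_row_uncons (n : nat) : measurable_fun setT (@row_uncons n).
Proof.
apply: measurable_fun_pair; first exact: measurable_coor.
apply/measurable_fun_rowP => i.
by under eq_fun do rewrite mxE; exact: measurable_coor.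
Qed.

Section step.
Variables (n : nat) (mu : {sigma_finite_measure set 'rV[R]_n -> \bar R}).

Definition lebesgue_row_step : set 'rV[R]_n.+1 -> \bar R :=
  pushforward (lebesgue_measure \x mu)%E (@row_cons n).

Let step0 : lebesgue_row_step set0 = 0%E.
Proof. by rewrite /lebesgue_row_step /pushforward preimage_set0 measure0. Qed.

Let step_ge0 A : (0 <= lebesgue_row_step A)%E.
Proof. by rewrite /lebesgue_row_step /pushforward measure_ge0. Qed.

Let step_sigma_additive : semi_sigma_additive lebesgue_row_step.
Proof.
move=> F mF tF mUF; rewrite /lebesgue_row_step /pushforward preimage_bigcup.
apply: measure_semi_sigma_additive.
- by move=> k; rewrite -[X in measurable X]setTI; exact: measurable_row_cons.
- apply/trivIsetP => /= i j _ _ ij; rewrite -preimage_setI.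
  by move/trivIsetP : tF => /(_ _ _ _ _ ij) ->//; rewrite preimage_set0.
- by rewrite -preimage_bigcup -[X in measurable X]setTI; exact: measurable_row_cons.
Qed.

HB.instance Definition _ := isMeasure.Build _ _ _ lebesgue_row_step
  step0 step_ge0 step_sigma_additive.

Let step_sigma_finite : sigma_finite setT lebesgue_row_step.
Proof.
have /sigma_finiteP[F [FT ndF Foo]] : sigma_finite setT (@lebesgue_measure R).
  exact: sigma_finiteT.
have /sigma_finiteP[G [GT ndG Goo]] := sigma_finiteT mu.
have FGT : setT `<=` \bigcup_k (F k `*` G k).
  move=> [x y] _; have [i _ Fix] : (\bigcup_k F k) x by rewrite -FT.
  have [j _ Gjy] : (\bigcup_k G k) y by rewrite -GT.
  exists (maxn i j) => //; split.
  - by move: x Fix; exact/subsetPset/ndF/leq_maxl.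
  - by move: y Gjy; exact/subsetPset/ndG/leq_maxr.
exists (fun k => @row_uncons n @^-1` (F k `*` G k)).
  by rewrite -preimage_bigcup; apply/esym; rewrite -subTset => x _; exact: FGT.
move=> k; have [mF Fk] := Foo k; have [mG Gk] := Goo k; split.
  rewrite -[X in measurable X]setTI; apply: measurable_row_uncons => //.
  exact: measurableX.
rewrite /lebesgue_row_step /pushforward -comp_preimage.
rewrite (_ : _ \o _ = id); last by apply/funext => z /=; rewrite row_consK.
by rewrite preimage_id product_measure1E// lte_mul_pinfty// ge0_fin_numE.
Qed.

HB.instance Definition _ := Measure_isSigmaFinite.Build _ _ _ lebesgue_row_step
  step_sigma_finite.

End step.

(* Lebesgue measure on R^n: the point mass for n = 0, and the product of the
   Lebesgue measures of R and of R^n for n.+1. *)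
Fixpoint lebesgue_row (n : nat) :
    {sigma_finite_measure set 'rV[R]_n -> \bar R} :=
  if n is n'.+1 then [the {sigma_finite_measure set 'rV[R]_n'.+1 -> \bar R} of
    lebesgue_row_step (lebesgue_row n')]
  else [the {sigma_finite_measure set 'rV[R]_0 -> \bar R} of \d_(0 : 'rV[R]_0)].

End lebesgue_row.

Section complex_valued.
Context {R : realType}.

Definition cabs (z : R[i]) : R := Normc.normc z.

Definition expi (t : R) : R[i] := (cos t +i* sin t)%C.

Context {d : measure_display} {T : measurableType d}.
Implicit Types (D : set T) (f : T -> R[i]).

Definition cmeasurable D f :=
  measurable_fun D (fun x => complex.Re (f x)) /\
  measurable_fun D (fun x => complex.Im (f x)).

Definition cintegrable (mu : {measure set T -> \bar R}) D f :=
  mu.-integrable D (fun x => (complex.Re (f x))%:E) /\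
  mu.-integrable D (fun x => (complex.Im (f x))%:E).

Definition cintegral (mu : {measure set T -> \bar R}) D f : R[i] :=
  (Rintegral mu D (fun x => complex.Re (f x)) +i*
   Rintegral mu D (fun x => complex.Im (f x)))%C.

Definition cLnorm (mu : {measure set T -> \bar R}) (p : \bar R) f : \bar R :=
  Lnorm mu p (fun x => (cabs (f x))%:E).

Definition inL (mu : {measure set T -> \bar R}) (p : \bar R) f :=
  cmeasurable setT f /\ (cLnorm mu p f < +oo)%E.

End complex_valued.

Section euclidean_space.
Context {R : realType} {n : nat}.
Local Notation Rn := 'rV[R]_n.
Local Notation mu := (lebesgue_row R n).
Implicit Types (b f g : Rn -> R[i]) (Q : set Rn).

Definition dotr (u v : Rn) : R := \sum_(i < n) u ord0 i * v ord0 i.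

Definition cube (a : Rn) (l : R) : set Rn :=
  [set x | forall i : 'I_n, a ord0 i <= x ord0 i <= a ord0 i + l].

Definition cubes : set (set Rn) :=
  [set Q | exists a l, 0 < l /\ Q = cube a l].

Definition loc_integrable b :=
  cmeasurable setT b /\ forall A : set Rn, compact A -> cintegrable mu A b.

Definition average b Q : R[i] :=
  ((fine (mu Q))^-1)%:C%C * cintegral mu Q b.

Definition BMO_seminorm b : \bar R :=
  ereal_sup [set ((fine (mu Q))^-1%:E *
                  \int[mu]_(x in Q) (cabs (b x - average b Q))%:E)%E
            | Q in cubes].

Definition BMO b := loc_integrable b /\ (BMO_seminorm b < +oo)%E.

Definition supp f : set Rn := closure [set x | f x != 0].

(* T acts on functions; being a map on Lebesgue spaces, it must respect almost
   everywhere equality, and its identities hold almost everywhere.  Its values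
   outside L^p1 x L^p2 are irrelevant. *)
Record bilinear_operator (p1 p2 : \bar R)
    (T : (Rn -> R[i]) -> (Rn -> R[i]) -> Rn -> R[i]) : Prop := {
  bilinear_measurable : forall f g, inL mu p1 f -> inL mu p2 g ->
    cmeasurable setT (T f g) ;
  bilinear_ae : forall f f' g g',
    inL mu p1 f -> inL mu p1 f' -> inL mu p2 g -> inL mu p2 g' ->
    {ae mu, forall x, f x = f' x} -> {ae mu, forall x, g x = g' x} ->
    {ae mu, forall x, T f g x = T f' g' x} ;
  bilinear_left : forall (c : R[i]) f f' g,
    inL mu p1 f -> inL mu p1 f' -> inL mu p2 g ->
    {ae mu, forall x, T (fun y => c * f y + f' y) g x = c * T f g x + T f' g x} ;
  bilinear_right : forall (c : R[i]) f g g',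
    inL mu p1 f -> inL mu p2 g -> inL mu p2 g' ->
    {ae mu, forall x, T f (fun y => c * g y + g' y) x = c * T f g x + T f g' x}
}.

(* The integral is a Lebesgue integral, hence absolutely convergent. *)
Definition represented_by (p1 p2 : \bar R)
    (T : (Rn -> R[i]) -> (Rn -> R[i]) -> Rn -> R[i])
    (K : Rn * Rn -> R[i]) :=
  forall f g, inL mu p1 f -> inL mu p2 g ->
    {ae mu, forall x, ~ (supp f `&` supp g) x ->
      let F := fun w : Rn * Rn => K (x - w.1, x - w.2) * f w.1 * g w.2 in
      cintegrable (mu \x mu)%E setT F /\
      T f g x = cintegral (mu \x mu)%E setT F}.

Definition homogeneous (s : R) (K : Rn * Rn -> R[i]) :=
  forall (l : R) (w : Rn * Rn), 0 < l -> w != (0, 0) ->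
    K (l *: w.1, l *: w.2) = (l `^ s)%:C%C * K w.

Definition ball2 (c : Rn * Rn) (r : R) : set (Rn * Rn) :=
  [set w | dotr (w.1 - c.1) (w.1 - c.1) + dotr (w.2 - c.2) (w.2 - c.2) < r ^+ 2].

(* A kernel is only defined off the origin, hence [w != (0, 0)]; [K w != 0]
   makes the inverse a genuine one, since [0^-1 = 0] here. *)
Definition inv_abs_fourier (K : Rn * Rn -> R[i]) (B : set (Rn * Rn)) :=
  exists (a : nat -> R[i]) (nu : nat -> Rn * Rn),
    cvgn (series (fun k => cabs (a k))) /\
    forall w, B w -> w != (0, 0) ->
      K w != 0 /\
      (fun N => cabs (\sum_(0 <= k < N)
         a k * expi (dotr (nu k).1 w.1 + dotr (nu k).2 w.2) - (K w)^-1))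
        @ \oo --> (0 : R).

Definition commutator1 b (T : (Rn -> R[i]) -> (Rn -> R[i]) -> Rn -> R[i]) f g :
    Rn -> R[i] :=
  fun x => b x * T f g x - T (fun y => b y * f y) g x.

Definition commutator2 b (T : (Rn -> R[i]) -> (Rn -> R[i]) -> Rn -> R[i]) f g :
    Rn -> R[i] :=
  fun x => b x * T f g x - T f (fun y => b y * g y) x.

(* T lives on L^p1 x L^p2 only, so [b,T]_1 (f, g) makes sense when b f is in
   L^p1, and [b,T]_2 (f, g) when b g is in L^p2. *)
Definition commutator1_bounded b T (p1 p2 q : \bar R) :=
  exists C : R, forall f g, inL mu p1 f -> inL mu p2 g ->
    inL mu p1 (fun y => b y * f y) ->
    inL mu q (commutator1 b T f g) /\
    (cLnorm mu q (commutator1 b T f g) <=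
       C%:E * cLnorm mu p1 f * cLnorm mu p2 g)%E.

Definition commutator2_bounded b T (p1 p2 q : \bar R) :=
  exists C : R, forall f g, inL mu p1 f -> inL mu p2 g ->
    inL mu p2 (fun y => b y * g y) ->
    inL mu q (commutator2 b T f g) /\
    (cLnorm mu q (commutator2 b T f g) <=
       C%:E * cLnorm mu p1 f * cLnorm mu p2 g)%E.

End euclidean_space.

(* Main.v *)
Require Import Defs.
From mathcomp Require Import all_boot all_order all_algebra.
From mathcomp Require Import all_classical all_reals all_analysis.
From mathcomp Require Import measurable_realfun ess_sup_inf complex ring lra.
Set Implicit Arguments.
Unset Strict Implicit.
Unset Printing Implicit Defensive.
Import Order.TTheory GRing.Theory Num.Theory.
Import numFieldNormedType.Exports.
Local Open Scope classical_set_scope.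
Local Open Scope ring_scope.

(** The commutator is tested on modulated indicator functions, and the Fourier
    expansion of $1/K$ turns these tests into a bound on the oscillation of $b$.

    Shrink the ball to a product of cubes with centre $c$ and half-side $e$ that
    avoids the origin ([box_in_ball2]).  Given a cube $Q$ of side $l$, put
    $t = e/l$ and let $Q_1$, $Q_2$ be the translates of $Q$ by $-c_1/t$,
    $-c_2/t$; then $(t(x-y), t(x-z))$ stays in the box for $x$ in $Q$, $y$ in
    $Q_1$, $z$ in $Q_2$.  In particular $Q$, $Q_1$, $Q_2$ have no common point,
    so on $Q$ the integral representation of $T$ applies to functions supported
    in $Q_1$ and $Q_2$.

    By homogeneity $1 = t^s K(x-y,x-z) / K(t(x-y),t(x-z))$ with
    $s = -2n+\alpha$, and $1/K(t(x-y),t(x-z))$ is an absolutely convergent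
    series of products of exponentials in $x$, $y$ and $z$.  Hence, for $E_1$ in
    $Q_1$ and $E_2$ in $Q_2$, integrating $b(x) - b(y)$ (or $b(x) - b(z)$) over
    $E_1\times E_2$ gives
    $|E_1||E_2|\,|b(x)-c'| \le t^s \sum_k |a_k|\,|[b,T]_j(f_k,g_k)(x)|$
    for almost every $x$ in $Q$, with $c'$ independent of $x$ and $f_k$, $g_k$
    exponentials restricted to $E_1$, $E_2$ ([oscillation_le_fourier]).
    Integrating over $Q$, Hoelder's inequality and the boundedness of the
    commutator bound the right-hand side; by the relation between the exponents
    all powers of $l$ combine to $l^{3n}$ ([scaling_exponents]), so the mean
    oscillation of $b$ on $Q$ about $c'$ is bounded uniformly in $Q$
    ([BMO_of_oscillation]).

    Since $b$ is only locally integrable, $b f_k$ need not lie in $L^{p_1}$ for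
    the indicator of a whole cube.  So $E_j$ is taken to be the part of $Q_j$
    where $|b|$ is below a threshold chosen, depending on the cube, to make
    $|E_j| \ge |Q_j|/2$ ([bounded_half_cube]).  The threshold does not enter the
    final constant: the estimate uses only the norms of $f_k$ and $g_k$.

    Both commutators are treated at once ([BMO_of_commutator]) by writing
    $b(y)$ or $b(z)$ as one function [beta] of the pair $(y, z)$. *)

(** * Complex moduli and complex integrals *)

Section complex_modulus.
Context {R : realType}.
Implicit Types z w : R[i].

Lemma cabs_ge0 z : 0 <= cabs z.
Proof. by case: z => x y; exact: sqrtr_ge0. Qed.

Lemma cabs0 : cabs (0 : R[i]) = 0.
Proof. exact: Normc.normc0. Qed.

Lemma cabsM z w : cabs (z * w) = cabs z * cabs w.
Proof. exact: Normc.normcM. Qed.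

Lemma cabs_real (x : R) : cabs (x%:C)%C = `|x|.
Proof. by rewrite /cabs /= expr0n/= addr0 sqrtr_sqr. Qed.

Lemma le_cabsD z w : cabs (z + w) <= cabs z + cabs w.
Proof. exact: le_normcD. Qed.

Lemma cabsN z : cabs (- z) = cabs z.
Proof. exact: normcN. Qed.

Lemma cabs_distrC z w : cabs (z - w) = cabs (w - z).
Proof. by rewrite -cabsN opprB. Qed.

Lemma normr_Re_le_cabs z : `|complex.Re z| <= cabs z.
Proof.
case: z => x y; rewrite /cabs /= -sqrtr_sqr ler_wsqrtr//.
by rewrite lerDl sqr_ge0.
Qed.

Lemma normr_Im_le_cabs z : `|complex.Im z| <= cabs z.
Proof.
case: z => x y; rewrite /cabs /= -sqrtr_sqr ler_wsqrtr//.
by rewrite lerDr sqr_ge0.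
Qed.

Lemma cabs_le_ReIm z : cabs z <= `|complex.Re z| + `|complex.Im z|.
Proof.
case: z => x y.
rewrite {1}(_ : (x +i* y)%C = (x%:C)%C + ((0 : R) +i* y)%C); last first.
  by simpc.
apply: le_trans (le_cabsD _ _) _; rewrite cabs_real lerD2l.
by rewrite /cabs /= expr0n/= add0r sqrtr_sqr.
Qed.

Lemma cabs_sum (I : Type) (r : seq I) (F : I -> R[i]) :
  cabs (\sum_(i <- r) F i) <= \sum_(i <- r) cabs (F i).
Proof.
elim/big_ind2: _ => //; first by rewrite cabs0.
by move=> z x w y zx wy; apply: le_trans (le_cabsD _ _) _; exact: lerD.
Qed.

Lemma cabs_expi (t : R) : cabs (expi t) = 1.
Proof. by rewrite /cabs /= cos2Dsin2 sqrtr1. Qed.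

Lemma expiD (s t : R) : expi (s + t) = expi s * expi t.
Proof. by rewrite /expi cosD sinD; simpc; congr (_ +i* _)%C; rewrite addrC. Qed.

Lemma ReM z w : complex.Re (z * w) =
  complex.Re z * complex.Re w - complex.Im z * complex.Im w.
Proof. by case: z w => [a b] [c d]. Qed.

Lemma ImM z w : complex.Im (z * w) =
  complex.Re z * complex.Im w + complex.Im z * complex.Re w.
Proof. by case: z w => [a b] [c d]. Qed.

Lemma ReD z w : complex.Re (z + w) = complex.Re z + complex.Re w.
Proof. by case: z w => [a b] [c d]. Qed.

Lemma ImD z w : complex.Im (z + w) = complex.Im z + complex.Im w.
Proof. by case: z w => [a b] [c d]. Qed.

End complex_modulus.

Section complex_measurable.
Context {R : realType} {d : measure_display} {T : measurableType d}.
Implicit Types (D : set T) (f g : T -> R[i]).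

Lemma cmeasurable_cst D (c : R[i]) : cmeasurable D (fun=> c).
Proof. by split; exact: measurable_cst. Qed.

Lemma cmeasurable_real D (f : T -> R) :
  measurable_fun D f -> cmeasurable D (fun x => (f x)%:C%C).
Proof. by move=> mf; split => //=; exact: measurable_cst. Qed.

Lemma cmeasurableD D f g : cmeasurable D f -> cmeasurable D g ->
  cmeasurable D (fun x => f x + g x).
Proof.
move=> [fr fi] [gr gi]; split.
  by under eq_fun do rewrite ReD; exact: measurable_funD.
by under eq_fun do rewrite ImD; exact: measurable_funD.
Qed.

Lemma cmeasurableM D f g : cmeasurable D f -> cmeasurable D g ->
  cmeasurable D (fun x => f x * g x).
Proof.
move=> [fr fi] [gr gi]; split.
  under eq_fun do rewrite ReM.
  by apply: measurable_funB; exact: measurable_funM.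
under eq_fun do rewrite ImM.
by apply: measurable_funD; exact: measurable_funM.
Qed.

Lemma cmeasurableB D f g : cmeasurable D f -> cmeasurable D g ->
  cmeasurable D (fun x => f x - g x).
Proof.
move=> mf mg; under eq_fun do rewrite -mulN1r.
by apply: cmeasurableD => //; apply: cmeasurableM => //; exact: cmeasurable_cst.
Qed.

Lemma cmeasurable_comp {d'} {U : measurableType d'} (h : U -> T) f :
  measurable_fun setT h -> cmeasurable setT f ->
  cmeasurable setT (fun x => f (h x)).
Proof.
by move=> mh [fr fi]; split;
  [exact: measurableT_comp fr mh|exact: measurableT_comp fi mh].
Qed.

Lemma cmeasurable_expi D (f : T -> R) :
  measurable_fun D f -> cmeasurable D (fun x => expi (f x)).
Proof.
move=> mf; split => /=.
  apply: measurableT_comp mf; apply: continuous_measurable_fun.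
  exact: continuous_cos.
apply: measurableT_comp mf; apply: continuous_measurable_fun.
exact: continuous_sin.
Qed.

Lemma measurable_cabs D f : cmeasurable D f ->
  measurable_fun D (fun x => cabs (f x)).
Proof.
move=> [fr fi]; rewrite (_ : (fun _ => _) =
  (fun x => (complex.Re (f x) ^+ 2 + complex.Im (f x) ^+ 2) `^ 2^-1)).
  apply: (@measurableT_comp _ _ _ _ _ _ (@powR R ^~ 2^-1)) => //.
  by apply: measurable_funD; exact: measurable_funX.
apply/funext => x; rewrite powR12_sqrt ?addr_ge0 ?sqr_ge0//.
by rewrite /cabs; case: (f x).
Qed.

Lemma measurable_cabsE D f : cmeasurable D f ->
  measurable_fun D (fun x => (cabs (f x))%:E).
Proof. by move=> mf; apply/measurable_EFinP; exact: measurable_cabs. Qed.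

End complex_measurable.

Section complex_integral.
Context {R : realType} {d : measure_display} {T : measurableType d}.
Variables (mu : {measure set T -> \bar R}) (D : set T) (mD : measurable D).
Implicit Types (f g : T -> R[i]).

Lemma cintegrable_measurable f : cintegrable mu D f -> cmeasurable D f.
Proof.
by move=> [fr fi]; split; apply/measurable_EFinP; apply: (measurable_int mu).
Qed.

Lemma cintegrable_cabs f : cintegrable mu D f ->
  mu.-integrable D (fun x => (cabs (f x))%:E).
Proof.
move=> ff; have mf := cintegrable_measurable ff; case: ff => fr fi.
apply: (@le_integrable _ _ _ _ _ mD _
  (fun x => `|(complex.Re (f x))%:E| + `|(complex.Im (f x))%:E|)%E).
- exact: measurable_cabsE.
- move=> x Dx /=; rewrite lee_fin ger0_norm ?cabs_ge0//.
  rewrite ger0_norm ?addr_ge0//; exact: cabs_le_ReIm.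
- by apply: integrableD => //; exact: integrable_abse.
Qed.

Lemma le_cintegrable f (g : T -> R) : cmeasurable D f ->
  (forall x, D x -> cabs (f x) <= g x) -> mu.-integrable D (EFin \o g) ->
  cintegrable mu D f.
Proof.
move=> [fr fi] fg ig; split.
  apply: le_integrable ig => //; first exact/measurable_EFinP.
  move=> x Dx /=; rewrite lee_fin (le_trans (normr_Re_le_cabs _))//.
  by rewrite (le_trans (fg _ Dx))// ler_norm.
apply: le_integrable ig => //; first exact/measurable_EFinP.
move=> x Dx /=; rewrite lee_fin (le_trans (normr_Im_le_cabs _))//.
by rewrite (le_trans (fg _ Dx))// ler_norm.
Qed.

Lemma cintegrableZ (c : R[i]) f :
  cintegrable mu D f -> cintegrable mu D (fun x => c * f x).
Proof.
move=> intf; apply: (@le_cintegrable _ (fun x => cabs c * cabs (f x))).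
- apply: cmeasurableM; [exact: cmeasurable_cst|exact: cintegrable_measurable].
- by move=> x _; rewrite cabsM.
- under [X in _.-integrable _ X]eq_fun do rewrite /= EFinM.
  by apply: integrableZl => //; exact: cintegrable_cabs.
Qed.

Lemma cintegrableD f g : cintegrable mu D f -> cintegrable mu D g ->
  cintegrable mu D (fun x => f x + g x).
Proof.
move=> [fr fi] [gr gi]; split.
  under [X in _.-integrable _ X]eq_fun do rewrite ReD EFinD.
  exact: integrableD.
under [X in _.-integrable _ X]eq_fun do rewrite ImD EFinD.
exact: integrableD.
Qed.

Lemma cintegrableB f g : cintegrable mu D f -> cintegrable mu D g ->
  cintegrable mu D (fun x => f x - g x).
Proof.
move=> intf intg; under [X in cintegrable _ _ X]eq_fun do rewrite -mulN1r.
by apply: cintegrableD => //; exact: cintegrableZ.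
Qed.

Lemma cintegrable_sum (I : Type) (r : seq I) (F : I -> T -> R[i]) :
  (forall i, cintegrable mu D (F i)) ->
  cintegrable mu D (fun x => \sum_(i <- r) F i x).
Proof.
move=> intF; elim: r => [|i r IHr].
  under [X in cintegrable _ _ X]eq_fun do rewrite big_nil.
  by split => /=; exact: integrable0.
under [X in cintegrable _ _ X]eq_fun do rewrite big_cons.
exact: cintegrableD.
Qed.

Lemma cintegralD f g : cintegrable mu D f -> cintegrable mu D g ->
  cintegral mu D (fun x => f x + g x) = cintegral mu D f + cintegral mu D g.
Proof.
move=> [fr fi] [gr gi]; rewrite /cintegral; simpc.
congr (_ +i* _)%C; rewrite -RintegralD//; apply: eq_Rintegral => x _.
  by rewrite ReD.
by rewrite ImD.
Qed.

Lemma cintegralZ (c : R[i]) f : cintegrable mu D f ->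
  cintegral mu D (fun x => c * f x) = c * cintegral mu D f.
Proof.
move=> [fr fi]; rewrite /cintegral; case: c => a b; simpc.
congr (_ +i* _)%C; rewrite -!RintegralZl//.
  rewrite -RintegralB//.
  - by apply: eq_Rintegral => x _; rewrite ReM.
  - exact: integrableZl fr.
  - exact: integrableZl fi.
rewrite -RintegralD//.
- by apply: eq_Rintegral => x _; rewrite ImM.
- exact: integrableZl fi.
- exact: integrableZl fr.
Qed.

Lemma cintegralB f g : cintegrable mu D f -> cintegrable mu D g ->
  cintegral mu D (fun x => f x - g x) = cintegral mu D f - cintegral mu D g.
Proof.
move=> intf intg; under [X in cintegral _ _ X]eq_fun do rewrite -mulN1r.
by rewrite cintegralD ?cintegralZ ?mulN1r//; exact: cintegrableZ.
Qed.

Lemma cintegral_sum (I : Type) (r : seq I) (F : I -> T -> R[i]) :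
  (forall i, cintegrable mu D (F i)) ->
  cintegral mu D (fun x => \sum_(i <- r) F i x) =
  \sum_(i <- r) cintegral mu D (F i).
Proof.
move=> intF; elim: r => [|i r IHr].
  under [X in cintegral _ _ X]eq_fun do rewrite big_nil.
  by rewrite big_nil /cintegral /= /Rintegral !integral0.
under [X in cintegral _ _ X]eq_fun do rewrite big_cons.
by rewrite cintegralD// ?IHr ?big_cons//; exact: cintegrable_sum.
Qed.

Lemma cintegral_real (f : T -> R) :
  cintegral mu D (fun x => (f x)%:C%C) = (Rintegral mu D f)%:C%C.
Proof. by rewrite /cintegral /= [X in (_ +i* X)%C]/Rintegral integral0. Qed.

(** Splitting into real and imaginary parts costs the factor 2, which is
    harmless for seminorm estimates. *)
Lemma le_cabs_cintegral f : cintegrable mu D f ->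
  ((cabs (cintegral mu D f))%:E <= 2%:E * \int[mu]_(x in D) (cabs (f x))%:E)%E.
Proof.
move=> intf; have := cintegrable_cabs intf; case: intf => fr fi fa.
have fin := integrable_fin_num mD fa.
rewrite -(fineK fin) -EFinM lee_fin.
apply: le_trans (cabs_le_ReIm _) _ => /=; rewrite mulr_natl mulr2n.
by apply: lerD; apply: le_trans (le_normr_Rintegral _ _) _ => //;
  apply: le_Rintegral => //; [exact: integrable_abse fr|
    move=> x _; exact: normr_Re_le_cabs|exact: integrable_abse fi|
    move=> x _; exact: normr_Im_le_cabs].
Qed.

(** Dominated convergence for the partial sums of a series, in the form of a
    triangle inequality for its integral. *)
Lemma cabs_cintegral_le_series (G : nat -> T -> R[i]) (S : T -> R[i])
    (g : T -> R) :
  (forall k, cintegrable mu D (G k)) ->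
  mu.-integrable D (EFin \o g) ->
  (forall N x, D x -> cabs (\sum_(0 <= k < N) G k x) <= g x) ->
  (forall x, D x ->
    (fun N => cabs (\sum_(0 <= k < N) G k x - S x)) @ \oo --> (0 : R)) ->
  ((cabs (cintegral mu D S))%:E <=
    \sum_(0 <= k <oo) (cabs (cintegral mu D (G k)))%:E)%E.
Proof.
move=> iG ig Gg GS.
have iP N := cintegrable_sum (index_iota 0 N) iG.
(* Real and imaginary part are handled together through these two properties. *)
pose part (p : R[i] -> R) := (forall z, `|p z| <= cabs z) /\
  {morph p : x y / x - y}.
have limpart p : part p ->
    (forall N, measurable_fun D (fun x => p (\sum_(0 <= k < N) G k x))) ->
    (fun N => Rintegral mu D (fun x => p (\sum_(0 <= k < N) G k x))) @ \oo -->
    Rintegral mu D (fun x => p (S x)).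
  move=> [pc pB] mp.
  have pS x : D x -> (fun N => p (\sum_(0 <= k < N) G k x)) @ \oo --> p (S x).
    move=> Dx; apply/subr_cvg0/norm_cvg0P.
    apply: (@squeeze_cvgr _ _ _ _ (cst 0)
      (fun N => cabs (\sum_(0 <= k < N) G k x - S x))).
    - by apply: nearW => N /=; rewrite normr_ge0/= -pB pc.
    - exact: cvg_cst.
    - exact: GS.
  have mS : measurable_fun D (fun x => p (S x)).
    by apply: (measurable_fun_cvg mp).
  have [| | | | |ipS _ cv] := @dominated_convergence _ _ _ mu _ mD
    (fun N x => (p (\sum_(0 <= k < N) G k x))%:E) (fun x => (p (S x))%:E)
    (EFin \o g).
  - by move=> N; apply/measurable_EFinP.
  - exact/measurable_EFinP.
  - by apply: aeW => x Dx; apply: cvg_EFin; [exact: nearW|exact: pS].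
  - exact: ig.
  - by apply: aeW => x N Dx; rewrite /= lee_fin (le_trans (pc _))// Gg.
  apply: fine_cvg => //=; rewrite /Rintegral fineK//.
  exact: integrable_fin_num ipS.
have partRe : part (@complex.Re R).
  by split; [exact: normr_Re_le_cabs|move=> [? ?] [? ?]].
have partIm : part (@complex.Im R).
  by split; [exact: normr_Im_le_cabs|move=> [? ?] [? ?]].
have cvRe := limpart _ partRe (fun N => (cintegrable_measurable (iP N)).1).
have cvIm := limpart _ partIm (fun N => (cintegrable_measurable (iP N)).2).
pose z := cintegral mu D S.
pose z_ N := cintegral mu D (fun x => \sum_(0 <= k < N) G k x).
have bz N : ((cabs (z_ N))%:E <=
    \sum_(0 <= k <oo) (cabs (cintegral mu D (G k)))%:E)%E.
  apply: (@le_trans _ _ (\sum_(0 <= k < N) (cabs (cintegral mu D (G k)))%:E)%E).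
    by rewrite sumEFin lee_fin /z_ cintegral_sum//; exact: cabs_sum.
  by apply: nneseries_lim_ge => k _ _; rewrite lee_fin cabs_ge0.
apply/lee_addgt0Pr => e e0.
have e20 : 0 < e / 2 by rewrite divr_gt0.
move/cvgrPdist_lt : cvRe => /(_ _ e20) [N1 _ hN1].
move/cvgrPdist_lt : cvIm => /(_ _ e20) [N2 _ hN2].
pose N := maxn N1 N2.
apply: (@le_trans _ _ ((cabs (z_ N))%:E + e%:E)%E); last exact: leeD2r.
rewrite -EFinD lee_fin -[X in cabs X](subrK (z_ N)) addrC.
apply: le_trans (le_cabsD _ _) _; rewrite lerD2l (le_trans (cabs_le_ReIm _))//.
rewrite [leRHS]splitr lerD// ltW//.
  by apply: hN1; rewrite /= leq_maxl.
by apply: hN2; rewrite /= leq_maxr.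
Qed.

End complex_integral.

(** * Lebesgue norms of bounded functions, and Hoelder's inequality on a set *)

Section norm_estimates.
Context {R : realType} {d : measure_display} {T : measurableType d}.
Variable mu : {measure set T -> \bar R}.
Local Open Scope ereal_scope.

(** At $p = \infty$ the exponent is $0$ and the right-hand side is $M$, so
    finite and infinite exponents share one formula. *)
Lemma cLnorm_le_indic (p : \bar R) (E : set T) (M : R) (f : T -> R[i]) :
  0 < p -> measurable E -> (0 <= M)%R -> cmeasurable setT f ->
  (forall x, cabs (f x) <= M * \1_E x)%R ->
  cLnorm mu p f <= M%:E * mu E `^ fine p^-1.
Proof.
move=> p0 mE M0 mf fM; rewrite /cLnorm unlock.
have fM1 x : (cabs (f x) <= M)%R.
  by rewrite (le_trans (fM x))// ler_piMr// indicE; case: (_ \in _).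
case: p p0 => [r|_|//].
  rewrite lte_fin => r0; rewrite inver gt_eqF//=.
  have -> : M%:E * mu E `^ r^-1 = (\int[mu]_x ((M `^ r)%:E * (\1_E x)%:E)) `^ r^-1.
    rewrite ge0_integralZl_EFin ?powR_ge0//; last first.
      by apply/measurable_EFinP; exact: measurable_indic.
    rewrite integral_indic// setIT poweRM ?lee_fin ?powR_ge0//.
    by rewrite poweR_EFin -powRrM mulfV ?gt_eqF// powRr1.
  apply: gt0_ler_poweR; rewrite ?invr_ge0 ?(ltW r0)//.
  - by rewrite in_itv/= leey andbT; apply: integral_ge0 => x _; rewrite lee_fin powR_ge0.
  - rewrite in_itv/= leey andbT; apply: integral_ge0 => x _.
    by rewrite -EFinM lee_fin mulr_ge0 ?powR_ge0.
  apply: ge0_le_integral => //.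
  - apply/measurable_EFinP.
    apply: (@measurableT_comp _ _ _ _ _ _ (@powR R ^~ r)) => //=.
    by apply: measurableT_comp => //; exact: measurable_cabs.
  - by apply/measurable_EFinP; apply: measurable_funM => //; exact: measurable_indic.
  - move=> x _ /=; rewrite lee_fin ger0_norm ?cabs_ge0//.
    have := fM x; rewrite indicE; case: (x \in E) => /=; rewrite ?mulr1 ?mulr0.
      by move=> ?; rewrite ge0_ler_powR ?nnegrE ?cabs_ge0// ltW.
    move=> f0; have -> : cabs (f x) = 0%R by apply/eqP; rewrite eq_le f0 cabs_ge0.
    by rewrite powR0 ?gt_eqF.
rewrite invey /= poweRe0 mule1; case: ifPn => // _.
apply/ess_supP; apply: aeW => x /=.
by rewrite lee_fin ger0_norm ?cabs_ge0.
Qed.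

(** Hoelder's inequality against the indicator function of [Q]. *)
Lemma integral_cabs_le_cLnorm (q : \bar R) (Q : set T) (f : T -> R[i]) :
  0 < q -> q^-1 < 1 -> measurable Q -> cmeasurable setT f ->
  \int[mu]_(x in Q) (cabs (f x))%:E <=
    cLnorm mu q f * mu Q `^ (1 - fine q^-1)%R.
Proof.
move=> q0 q1 mQ mf; rewrite /cLnorm.
case: q q0 q1 => [r|_ _|//].
  rewrite lte_fin => r0; rewrite inver gt_eqF//= lte_fin => r1.
  pose s : R := (1 - r^-1)%R^-1%R.
  have s0 : (0 < s)%R by rewrite invr_gt0 subr_gt0.
  have rs : (r^-1 + s^-1 = 1)%R by rewrite /s invrK addrC subrK.
  have mc : measurable_fun setT (fun x => cabs (f x)) by exact: measurable_cabs.
  have := hoelder mu mc (measurable_indic mQ) r0 s0 rs.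
  rewrite Lnorm1 => /(le_trans _)/= H.
  have -> : mu Q `^ (1 - r^-1)%R = Lnorm mu s%:E (EFin \o \1_Q).
    rewrite unlock /Lnorm /s invrK; congr (_ `^ _).
    rewrite -[X in mu X](setIT Q) -integral_indic//; apply: eq_integral => x _ /=.
    rewrite indicE; case: (x \in Q) => /=.
      by rewrite mulr1n normr1 powR1.
    by rewrite mulr0n normr0 powR0// gt_eqF.
  apply: H; rewrite integral_mkcond; apply: ge0_le_integral => //.
  - by move=> x _; apply: erestrict_ge0 => y _; rewrite lee_fin cabs_ge0.
  - apply/(measurable_restrictT _ mQ); exact: measurable_funS (measurable_cabsE mf).
  - apply/measurable_EFinP; apply: measurableT_comp => //.
    by apply: measurable_funM => //; exact: measurable_indic.
  - move=> x _; rewrite /patch indicE; case: (x \in Q) => /=.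
      by rewrite lee_fin mulr1 ler_norm.
    by rewrite lee_fin.
rewrite invey/= subr0 poweRe1// unlock; case: ifPn => [mT|].
  have ac := ess_sup_ge mu (abse \o (fun x => (cabs (f x))%:E)).
  rewrite -integral_cst//; apply: ae_ge0_le_integral => //.
  - by move=> x _; rewrite lee_fin cabs_ge0.
  - exact: measurable_funS (measurable_cabsE mf).
  - move=> x _; by apply: ess_sup_gee => //; apply: aeW => y /=; rewrite lee_fin.
  - apply: filterS ac => x /= H _; apply: le_trans H.
    by rewrite lee_fin ler_norm.
rewrite -leNgt => muT0; rewrite mul0e.
have Q0 : mu Q = 0.
  by apply/eqP; rewrite -measure_le0 (le_trans _ muT0)// le_measure ?inE.
rewrite null_set_integral//; exact: measurable_funS (measurable_cabsE mf).
Qed.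
End norm_estimates.

(** * Cubes, and boxes in a ball *)

Section cubes.
Context {R : realType} {n : nat}.
Implicit Types (a : 'rV[R]_n) (l : R).

Lemma cubeE a l :
  cube a l = \bigcap_(i in [set: 'I_n])
    (fun x : 'rV[R]_n => x ord0 i) @^-1` `[a ord0 i, a ord0 i + l]%classic.
Proof.
by apply/seteqP; split => x /= H i; have := H i; rewrite /= in_itv/=; auto.
Qed.

Lemma measurable_cube a l : measurable (cube a l).
Proof.
rewrite cubeE; apply: fin_bigcap_measurable => // i _.
by rewrite -[X in measurable X]setTI; exact: measurable_coor.
Qed.

Lemma closed_cube a l : closed (cube a l).
Proof.
rewrite cubeE; apply: closed_bigI => i _.
apply: (continuous_closedP _).1; last exact: interval_closed.
exact: coord_continuous.
Qed.

Lemma compact_cube a l : compact (cube a l).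
Proof.
have /= := @rV_compact R n (fun i => `[a ord0 i, a ord0 i + l]%classic)
  (fun i => @segment_compact _ _ _).
by congr compact; apply/seteqP; split => x /= H i; have := H i; rewrite /= in_itv.
Qed.

Lemma supp_sub_cube a l (f : 'rV[R]_n -> R[i]) :
  (forall x, ~ cube a l x -> f x = 0) -> supp f `<=` cube a l.
Proof.
move=> f0; rewrite /supp (closure_id (cube a l)).1; last exact: closed_cube.
by apply: closure_subset => x /= fx; apply: contrapT => /f0; exact/eqP.
Qed.

End cubes.

(** Lebesgue measure on rows is built by splitting off one coordinate at a time,
    and a cube splits accordingly into an interval times a smaller cube. *)
Lemma lebesgue_cube (R : realType) (n : nat) (a : 'rV[R]_n) (l : R) : 0 <= l ->
  lebesgue_row R n (cube a l) = (l ^+ n)%:E.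
Proof.
move=> l0; elim: n a => [|n IHn] a.
  rewrite /= /dirac indicE mem_set//.
  by move=> [].
rewrite /= /lebesgue_row_step /pushforward.
rewrite (_ : _ @^-1` _ = `[a ord0 ord0, a ord0 ord0 + l]%classic `*`
   cube (\row_i a ord0 (lift ord0 i)) l); last first.
  apply/seteqP; split => [[x y]|[x y]] /=.
    move=> H; split.
      by have := H ord0; rewrite mxE unlift_none in_itv.
    by move=> i; have := H (lift ord0 i); rewrite !mxE liftK.
  move=> [+ H] i; rewrite in_itv /= => xa.
  case: (unliftP ord0 i) => [j|] ->; rewrite mxE.
    by rewrite liftK; have := H j; rewrite mxE.
  by rewrite unlift_none.
rewrite product_measure1E//; last exact: measurable_cube.
rewrite [X in (_ * X)%E]IHn /= lebesgue_measure_itv/= lte_fin ltrDl.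
case: ltgtP l0 => // [l0 _|<- _].
  by rewrite -EFinD addrAC subrr add0r -EFinM exprS.
by rewrite mul0e exprS mul0r.
Qed.

(** The centre of the ball may be the origin, so its first [n] coordinates are
    shifted by twice the half-side, away from zero for the leading one. *)
Lemma box_in_ball2 (R : realType) (n : nat) (c : 'rV[R]_n * 'rV[R]_n) (r : R) :
  (0 < n)%N -> 0 < r ->
  exists (c' : 'rV[R]_n * 'rV[R]_n) (e : R), 0 < e /\
    forall w : 'rV[R]_n * 'rV[R]_n,
      (forall i, `|w.1 ord0 i - c'.1 ord0 i| <= e) ->
      (forall i, `|w.2 ord0 i - c'.2 ord0 i| <= e) ->
      ball2 c r w /\ w != (0, 0).
Proof.
move=> n0 r0; pose h := r / (4 * n%:R).
have nR0 : 0 < n%:R :> R by rewrite ltr0n.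
have h0 : 0 < h by rewrite divr_gt0// mulr_gt0.
pose i0 := Ordinal n0.
(* Moving away from zero keeps the shifted coordinate of modulus at least h. *)
pose s : R := if 0 <= c.1 ord0 i0 then h else - h.
exists (c.1 + const_mx s, c.2), (h / 2); split; first by rewrite divr_gt0.
move=> [w1 w2] /= H1 H2; split.
  rewrite /ball2 /dotr /= -big_split /=.
  have H i : (w1 - c.1) ord0 i * (w1 - c.1) ord0 i +
       (w2 - c.2) ord0 i * (w2 - c.2) ord0 i <= 5 * h ^+ 2.
    have := H1 i; have := H2 i; rewrite !mxE => A2 A1.
    have {}A1 : `|w1 ord0 i - c.1 ord0 i| <= 2 * h.
      have -> : w1 ord0 i - c.1 ord0 i = w1 ord0 i - (c.1 ord0 i + s) + s by ring.
      rewrite (le_trans (ler_normD _ _))//.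
      have : `|s| = h by rewrite /s; case: ifP; rewrite ?normrN gtr0_norm.
      by move=> ->; lra.
    have sqE (x : R) : x * x = `|x| ^+ 2 by rewrite real_normK ?num_real// expr2.
    rewrite !{}sqE.
    have B1 : `|w1 ord0 i - c.1 ord0 i| ^+ 2 <= (2 * h) ^+ 2.
      by rewrite lerXn2r ?nnegrE ?mulr_ge0// ltW.
    have B2 : `|w2 ord0 i - c.2 ord0 i| ^+ 2 <= (h / 2) ^+ 2.
      by rewrite lerXn2r ?nnegrE ?divr_ge0// ltW.
    nra.
  apply: le_lt_trans (ler_sum _ (fun i _ => H i)) _.
  rewrite sumr_const card_ord -mulr_natl.
  have hn : r = 4 * n%:R * h by rewrite /h mulrC divfK// mulf_neq0// gt_eqF.
  rewrite hn; have : (1 : R) <= n%:R by rewrite ler1n.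
  nra.
apply/eqP => -[w10 _]; have := H1 i0; rewrite w10 !mxE /s.
case: ifPn => c0; rewrite sub0r normrN.
  by rewrite ger0_norm; lra.
by rewrite -normrN ger0_norm; lra.
Qed.

(** The truncations of $A$ increase to $A$, so their measures converge to the
    measure of $A$. *)
Lemma mu_truncation (R : realType) (d : measure_display) (T : measurableType d)
    (mu : {measure set T -> \bar R}) (A : set T) (b : T -> R[i]) :
  measurable A -> cmeasurable setT b -> (0 < mu A < +oo)%E ->
  exists N : nat, measurable (A `&` [set x | cabs (b x) <= N%:R]) /\
    (mu A * 2^-1%:E <= mu (A `&` [set x | (cabs (b x) <= N%:R)%R]))%E.
Proof.
move=> mA mb /andP[A0 Aoo].
pose F N := A `&` [set x | (cabs (b x) <= N%:R)%R].
have mF N : measurable (F N).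
  apply: measurableI => //.
  rewrite (_ : [set _ | _] = (fun x => cabs (b x)) @^-1` `]-oo, N%:R]%classic).
    by rewrite -[X in measurable X]setTI; exact: measurable_cabs.
  by apply/seteqP; split => x /=; rewrite in_itv.
have UF : \bigcup_N F N = A.
  apply/seteqP; split => [x [N _ []]//|x Ax].
  exists (Num.truncn (cabs (b x))).+1 => //; split => //=.
  by rewrite ltW// truncnS_gt.
have cvF : mu (F N) @[N --> \oo] --> mu A.
  rewrite -[in X in _ --> X]UF; apply: nondecreasing_cvg_mu => //; first by rewrite UF.
  move=> N M NM; apply/subsetPset => x [Ax /= bN]; split => //=.
  by rewrite (le_trans bN)// ler_nat.
have Afin : mu A \is a fin_num by rewrite ge0_fin_numE.
apply: contrapT => /forallNP H.
have : (mu A <= mu A * 2^-1%:E)%E.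
  rewrite -[leLHS](cvg_lim _ cvF)//; apply: lime_le; first by apply/cvg_ex; exists (mu A).
  by apply: nearW => N; rewrite ltW// ltNge; apply/negP => h; exact: H N (conj (mF N) h).
rewrite -(fineK Afin) -EFinM lee_fin.
have : 0 < fine (mu A) by rewrite fine_gt0// A0.
lra.
Qed.

(** * Mean oscillation *)

Lemma integrable_cst_lty (R : realType) (d : measure_display)
    (T : measurableType d) (mu : {measure set T -> \bar R}) (D : set T) (c : R) :
  measurable D -> (mu D < +oo)%E -> mu.-integrable D (EFin \o cst c).
Proof.
move=> mD muD; apply/integrableP; split.
  by apply/measurable_EFinP; exact: measurable_cst.
under eq_integral do rewrite /=.
by rewrite integral_cst// lte_mul_pinfty// lee_fin.
Qed.

(** On each cube any constant may replace the average, which itself differs from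
    that constant by no more than twice the mean oscillation about it. *)
Lemma BMO_of_oscillation (R : realType) (n : nat) (b : 'rV[R]_n -> R[i]) (M : R) :
  loc_integrable b ->
  (forall a l, 0 < l -> exists c : R[i],
    (\int[lebesgue_row R n]_(x in cube a l) (cabs (b x - c))%:E <=
       (M * l ^+ n)%:E)%E) ->
  BMO b.
Proof.
move=> hb osc; split => //; apply: (@le_lt_trans _ _ (3 * M)%:E); last by rewrite ltry.
apply: ub_ereal_sup => _ [_ [a [l [l0 ->]]] <-].
have [c hc] := osc a l l0.
set mu : {measure set 'rV[R]_n -> \bar R} := lebesgue_row R n in hc *.
set Q := cube a l in hc *.
have mQ : measurable Q by exact: measurable_cube.
have muQ : mu Q = (l ^+ n)%:E by apply: lebesgue_cube; exact: ltW.
have V0 : 0 < l ^+ n by rewrite exprn_gt0.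
have ib : cintegrable mu Q b by apply: hb.2; exact: compact_cube.
have ic (z : R[i]) : cintegrable mu Q (fun=> z).
  apply: (@le_cintegrable _ _ _ _ _ mQ _ (fun=> cabs z)) => //.
  by apply: integrable_cst_lty => //; rewrite muQ ltry.
have ibz z := cintegrableB mQ ib (ic z).
have mabs z : measurable_fun Q (fun x => (cabs (b x - z))%:E).
  exact: measurable_cabsE (cintegrable_measurable (ibz z)).
have cst_int (z : R[i]) : cintegral mu Q (fun=> z) = (l ^+ n)%:C%C * z.
  rewrite /cintegral !Rintegral_cst//; rewrite muQ /=; case: z => u v; simpc.
  by congr (_ +i* _)%C; rewrite mulrC.
rewrite muQ /=.
have dist : cabs (c - average b Q) <= 2 * M.
  rewrite /average muQ /= cabs_distrC.
  have -> : ((l ^+ n)^-1)%:C%C * cintegral mu Q b - c =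
      ((l ^+ n)^-1)%:C%C * cintegral mu Q (fun x => b x - c).
    rewrite cintegralB// cst_int mulrBr mulrA -rmorphM/= mulVf ?gt_eqF//.
    by rewrite mul1r.
  rewrite cabsM cabs_real ger0_norm ?invr_ge0 ?(ltW V0)// ler_pdivrMl//.
  rewrite -lee_fin (le_trans (le_cabs_cintegral mQ (ibz c)))//.
  apply: (@le_trans _ _ (2%:E * (M * l ^+ n)%:E)%E); first by rewrite lee_pmul2l.
  by rewrite -EFinM lee_fin; nra.
have H : (\int[mu]_(x in Q) (cabs (b x - average b Q))%:E <=
    (3 * M * l ^+ n)%:E)%E.
  apply: (@le_trans _ _ (\int[mu]_(x in Q) ((cabs (b x - c))%:E + (2 * M)%:E))%E).
    apply: ge0_le_integral => //.
    - by move=> x _; rewrite lee_fin cabs_ge0.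
    - by apply: emeasurable_funD => //; exact: mabs.
    - move=> x _; rewrite -EFinD lee_fin.
      have -> : b x - average b Q = b x - c + (c - average b Q).
        by rewrite addrA subrK.
      by rewrite (le_trans (le_cabsD _ _))// lerD2l.
  have M0 : 0 <= 2 * M by rewrite (le_trans _ dist)// cabs_ge0.
  rewrite ge0_integralD//; last by move=> x _; rewrite lee_fin cabs_ge0.
  rewrite integral_cst// muQ.
  apply: (le_trans (leeD2r _ hc)); rewrite -EFinM -EFinD lee_fin; nra.
rewrite -[leRHS]mul1e -(_ : ((l ^+ n)^-1 * l ^+ n)%:E = 1%E); last first.
  by rewrite mulVf// gt_eqF.
rewrite EFinM -muleA lee_pmul2l ?fin_numE// ?lte_fin ?invr_gt0//.
by rewrite muleC.
Qed.

(** * Fourier expansion of the reciprocal kernel *)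

Lemma integrable_scaled_indic (R : realType) (d : measure_display)
    (T : measurableType d) (mu : {measure set T -> \bar R}) (E : set T) (r : R) :
  measurable E -> (mu E < +oo)%E ->
  mu.-integrable setT (EFin \o (fun x => r * \1_E x)).
Proof.
move=> mE muE.
have := (integrable_mkcond (EFin \o cst r) mE).1 (integrable_cst_lty r mE muE).
congr (_.-integrable _ _); apply/funext => x; rewrite /patch /= indicE.
by case: (x \in E); rewrite /= ?mulr1 ?mulr0.
Qed.

Section modulated_indicators.
Context {R : realType} {n : nat}.
Local Notation Rn := 'rV[R]_n.

(** The sign makes [wave] cancel the dependence on [y] of an exponential in
    [x - y]. *)
Definition wave (E : set Rn) (u : Rn) (x : Rn) : R[i] :=
  (\1_E x)%:C%C * expi (- dotr u x).

Lemma dotrZl (t : R) (u v : Rn) : dotr (t *: u) v = t * dotr u v.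
Proof. by rewrite /dotr mulr_sumr; apply: eq_bigr => i _; rewrite mxE mulrA. Qed.

Lemma dotrZr (t : R) (u v : Rn) : dotr u (t *: v) = t * dotr u v.
Proof. by rewrite /dotr mulr_sumr; apply: eq_bigr => i _; rewrite mxE mulrCA. Qed.

Lemma dotrBr (u v w : Rn) : dotr u (v - w) = dotr u v - dotr u w.
Proof.
by rewrite /dotr -sumrB; apply: eq_bigr => i _; rewrite !mxE mulrBr.
Qed.

Lemma measurable_dotr (u : Rn) : measurable_fun setT (dotr u).
Proof.
apply: measurable_sum => i; apply: measurable_funM => //.
exact: measurable_coor.
Qed.

Lemma cabs_wave E u x : cabs (wave E u x) = \1_E x.
Proof. by rewrite /wave cabsM cabs_real cabs_expi mulr1 ger0_norm. Qed.

Lemma cmeasurable_wave E u : measurable E -> cmeasurable setT (wave E u).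
Proof.
move=> mE; apply: cmeasurableM.
  by apply: cmeasurable_real; exact: measurable_indic.
apply: cmeasurable_expi; apply: measurableT_comp => //; exact: measurable_dotr.
Qed.

Lemma wave_out E u x : ~ E x -> wave E u x = 0.
Proof. by move=> Ex; rewrite /wave indicE memNset// mul0r. Qed.

Lemma wave_in (E : set Rn) u x : E x -> wave E u x = expi (- dotr u x).
Proof. by move=> Ex; rewrite /wave indicE mem_set// mul1r. Qed.

End modulated_indicators.

Section fourier_expansion.
Context {R : realType} {n : nat}.
Local Notation Rn := 'rV[R]_n.
Local Notation mu := (lebesgue_row R n).

(** The heart of the argument, at a fixed point [x] where [bx] is the value of
    the symbol.  On $E_1\times E_2$ homogeneity and the expansion of $1/K$ give
    $b(x) - \beta = t^s \sum_k a_k e_k(x) (b(x) - \beta) F_k$, where $e_k(x)$ is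
    unimodular and comes from splitting the exponential in $(x-y, x-z)$ into its
    dependence on $x$ and on $(y,z)$.  Every partial sum is dominated by a
    multiple of $|b(x) - \beta||F_0|$, because all $|F_k|$ are equal; so the
    series may be integrated term by term. *)
Lemma oscillation_le_fourier (K : Rn * Rn -> R[i]) (s t A N0 : R)
    (a : nat -> R[i]) (nu : nat -> Rn * Rn) (E1 E2 : set Rn)
    (beta : Rn * Rn -> R[i]) (bx : R[i]) (x : Rn) :
  homogeneous s K -> 0 < t ->
  (forall N, \sum_(0 <= k < N) cabs (a k) <= A) ->
  measurable E1 -> measurable E2 -> (mu E1 < +oo)%E -> (mu E2 < +oo)%E ->
  cmeasurable setT beta ->
  (forall y z, E1 y -> E2 z -> cabs (beta (y, z)) <= N0) ->
  (forall y z, E1 y -> E2 z -> let w := (t *: (x - y), t *: (x - z)) in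
    w != (0, 0) /\ K w != 0 /\
    (fun N => cabs (\sum_(0 <= k < N)
       a k * expi (dotr (nu k).1 w.1 + dotr (nu k).2 w.2) - (K w)^-1))
      @ \oo --> (0 : R)) ->
  let F k (w : Rn * Rn) := K (x - w.1, x - w.2) *
    wave E1 (t *: (nu k).1) w.1 * wave E2 (t *: (nu k).2) w.2 in
  (forall k, cintegrable (mu \x mu)%E setT (F k)) ->
  (forall k, cintegrable (mu \x mu)%E setT (fun w => beta w * F k w)) ->
  ((cabs (bx * (fine (mu E1 * mu E2)%E)%:C%C - cintegral (mu \x mu)%E setT
      (fun w => beta w * (\1_(E1 `*` E2) w)%:C%C)))%:E <=
    \sum_(0 <= k <oo) (t `^ s * cabs (a k) *
      cabs (bx * cintegral (mu \x mu)%E setT (F k) -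
            cintegral (mu \x mu)%E setT (fun w => beta w * F k w)))%:E)%E.
Proof.
move=> hK t0 hA mE1 mE2 E1oo E2oo mbeta hbeta hW F iF ibF.
set c0 := cintegral _ _ (fun w => beta w * _).
pose mm : {measure set (Rn * Rn) -> \bar R} := (mu \x mu)%E.
pose E := E1 `*` E2.
have mE : measurable E by exact: measurableX.
have mmE : mm E = (mu E1 * mu E2)%E by apply: product_measure1E.
have mmEoo : (mm E < +oo)%E by rewrite mmE lte_mul_pinfty// ge0_fin_numE.
have mT : measurable [set: Rn * Rn] by [].
have iind (r : R) : mm.-integrable setT (EFin \o (fun w => r * \1_E w)).
  exact: integrable_scaled_indic.
have m1 : cmeasurable setT (fun w => (\1_E w)%:C%C : R[i]).
  by apply: cmeasurable_real; exact: measurable_indic.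
have i1 : cintegrable mm setT (fun w => (\1_E w)%:C%C).
  apply: (le_cintegrable mT m1 _ (iind 1)) => w _.
  by rewrite cabs_real mul1r ger0_norm.
have ib1 : cintegrable mm setT (fun w => beta w * (\1_E w)%:C%C).
  apply: (le_cintegrable mT (cmeasurableM mbeta m1) _ (iind N0)) => -[y z] _.
  rewrite cabsM cabs_real ger0_norm// indicE.
  have [[/= yE zE]|yzE] := pselect (E (y, z)).
    by rewrite mem_set// !mulr1 hbeta.
  by rewrite memNset// !mulr0.
pose e k := expi (t * (dotr (nu k).1 x + dotr (nu k).2 x)).
pose G k w := (t `^ s)%:C%C * (a k * e k) * (bx * F k w - beta w * F k w).
pose S w := bx * (\1_E w)%:C%C - beta w * (\1_E w)%:C%C.
pose g w := t `^ s * A * cabs (bx * F 0%N w - beta w * F 0%N w).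
have iD k : cintegrable mm setT (fun w => bx * F k w - beta w * F k w).
  by apply: cintegrableB => //; exact: cintegrableZ.
have iG k : cintegrable mm setT (G k) by exact: cintegrableZ.
pose P (w : Rn * Rn) N := \sum_(0 <= k < N)
   a k * expi (dotr (nu k).1 (t *: (x - w.1)) + dotr (nu k).2 (t *: (x - w.2))).
have FN k w : ~ E w -> F k w = 0.
  move=> Ew; rewrite /F; have [E1w|E1w] := pselect (E1 w.1); last first.
    by rewrite (wave_out _ E1w) mulr0 mul0r.
  by rewrite (@wave_out _ _ E2) ?mulr0// => E2w; exact: Ew.
have GN w N : ~ E w -> \sum_(0 <= k < N) G k w = 0.
  by move=> Ew; rewrite big1// => k _; rewrite /G FN// !mulr0 subr0 mulr0.
have GE w N : E w -> \sum_(0 <= k < N) G k w =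
    (t `^ s)%:C%C * K (x - w.1, x - w.2) * (bx - beta w) * P w N.
  move=> [E1w E2w]; rewrite mulr_sumr; apply: eq_bigr => k _.
  rewrite /G /F (wave_in _ E1w) (wave_in _ E2w).
  have -> : expi (dotr (nu k).1 (t *: (x - w.1)) + dotr (nu k).2 (t *: (x - w.2)))
     = e k * (expi (- dotr (t *: (nu k).1) w.1) * expi (- dotr (t *: (nu k).2) w.2)).
    rewrite /e -!expiD !dotrZr !dotrZl !dotrBr; congr expi; ring.
  ring.
have KE w : E w -> K (t *: (x - w.1), t *: (x - w.2)) =
    (t `^ s)%:C%C * K (x - w.1, x - w.2).
  move=> [E1w E2w]; apply: (hK t (x - w.1, x - w.2)) => //; apply/eqP => xw0.
  have [/eqP + _] := hW _ _ E1w E2w; apply.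
  by case: xw0 => -> ->; rewrite !scaler0.
have SE w : E w -> S w = bx - beta w.
  by move=> Ew; rewrite /S indicE mem_set// !mulr1.
have F0 w : E w -> cabs (F 0%N w) = cabs (K (x - w.1, x - w.2)).
  by move=> [E1w E2w]; rewrite /F 2!cabsM !cabs_wave !indicE !mem_set// !mulr1.
have PA w N : cabs (P w N) <= A.
  apply: le_trans (hA N); apply: le_trans (cabs_sum _ _) _.
  by apply: ler_sum => k _; rewrite cabsM cabs_expi mulr1.
have A0 : 0 <= A by have := hA 0%N; rewrite big_nil.
have -> : bx * (fine (mu E1 * mu E2)%E)%:C%C - c0 = cintegral mm setT S.
  rewrite cintegralB//; last exact: cintegrableZ.
  rewrite cintegralZ// cintegral_real; congr (bx * _%:C%C - _).
  by rewrite /Rintegral integral_indic// setIT mmE.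
under eq_eseriesr.
  move=> k _.
  have -> : t `^ s * cabs (a k) * cabs (bx * cintegral mm setT (F k) -
      cintegral mm setT (fun w => beta w * F k w)) = cabs (cintegral mm setT (G k)).
    rewrite /G cintegralZ// cintegralB//; last exact: cintegrableZ.
    by rewrite cintegralZ// !cabsM cabs_real cabs_expi mulr1 ger0_norm ?powR_ge0.
  over.
apply: (cabs_cintegral_le_series mT iG (g := g)).
- exact: (integrableZl mT (t `^ s * A) (cintegrable_cabs mT (iD 0%N))).
- move=> N w _; rewrite /g; have [Ew|Ew] := pselect (E w); last first.
    by rewrite GN// cabs0 mulr_ge0 ?cabs_ge0// mulr_ge0 ?powR_ge0.
  rewrite GE// !cabsM cabs_real ger0_norm ?powR_ge0// -mulrBl cabsM F0//.
  rewrite (mulrC (cabs (bx - _))) -!mulrA ler_wpM2l ?powR_ge0//.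
  rewrite [leLHS]mulrA [leLHS]mulrC; apply: ler_wpM2r; last exact: PA.
  by rewrite mulr_ge0 ?cabs_ge0.
- move=> w _; have [Ew|Ew] := pselect (E w); last first.
    under eq_fun do rewrite GN// /S indicE memNset// !mulr0 subrr subrr cabs0.
    exact: cvg_cst.
  have [_ [K0 cv]] := hW _ _ Ew.1 Ew.2.
  rewrite /= KE// in K0 cv.
  pose k0 := (t `^ s)%:C%C * K (x - w.1, x - w.2) * (bx - beta w).
  have -> : (fun N => cabs (\sum_(0 <= k < N) G k w - S w)) =
     (fun N => cabs k0 * cabs (P w N - ((t `^ s)%:C%C * K (x - w.1, x - w.2))^-1)).
    apply/funext => N; rewrite -cabsM GE// SE// -/k0; congr cabs.
    rewrite mulrBr; congr (_ - _).
    by rewrite /k0 mulrAC mulfV ?mul1r.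
  rewrite -(mulr0 (cabs k0)); apply: cvgM; first exact: cvg_cst.
  exact: cv.
Qed.
End fourier_expansion.

(** * From a bounded commutator to bounded mean oscillation *)

(** The exponent relation makes the final estimate scale like the volume of the
    cube; here [V] is that volume and [e / l] the dilation that brings the
    configuration of cubes to unit scale. *)
Lemma scaling_exponents (R : realType) (n : nat) (l e u1 u2 v alpha : R) :
  (0 < n)%N -> 0 < l -> 0 < e -> v = u1 + u2 - alpha / n%:R ->
  (e / l) `^ (- (2 * n)%:R + alpha) *
    ((l ^+ n) `^ u1 * (l ^+ n) `^ u2 * (l ^+ n) `^ (1 - v)) =
  e `^ (- (2 * n)%:R + alpha) * (l ^+ n) ^+ 3.
Proof.
move=> n0 l0 e0 ->; set s := - (2 * n)%:R + alpha.
have nR0 : n%:R != 0 :> R by rewrite pnatr_eq0 -lt0n.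
have -> : (e / l) `^ s = e `^ s * l `^ (- s).
  by rewrite powRM ?invr_ge0 ?ltW// -powR_inv1 ?ltW// -powRrM mulN1r.
rewrite -mulrA; congr (_ * _); rewrite -[in RHS]exprM -!powR_mulrn ?ltW//.
rewrite -!powRrM -!powRD ?(gt_eqF l0) ?implybT//; congr (_ `^ _).
by rewrite /s !natrM; field.
Qed.

Lemma inve_fin (R : realType) (p : \bar R) : (0 < p)%E ->
  exists2 u : R, 0 <= u & (p^-1 = u%:E)%E.
Proof.
case: p => [r|_|//].
  by rewrite lte_fin => r0; exists r^-1; rewrite ?invr_ge0 ?ltW// inver gt_eqF.
by exists 0.
Qed.

Lemma le_poweR_fin (R : realType) (x : \bar R) (V u : R) :
  (0 <= x)%E -> (x <= V%:E)%E -> 0 <= u -> (x `^ u <= (V `^ u)%:E)%E.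
Proof.
move=> x0 xV u0; rewrite -poweR_EFin.
by apply: gt0_ler_poweR; rewrite // in_itv/= leey andbT// (le_trans x0).
Qed.

Section commutator_to_BMO.
Context {R : realType} {n : nat}.
Local Notation Rn := 'rV[R]_n.
Local Notation mu := (lebesgue_row R n).

Lemma inL_wave (p : \bar R) (E : set Rn) (u : Rn) :
  (0 < p)%E -> measurable E -> (mu E < +oo)%E -> inL mu p (wave E u).
Proof.
move=> p0 mE Eoo; have mw := cmeasurable_wave u mE; split => //.
have [v v0 pv] := inve_fin p0.
have wE x : cabs (wave E u x) <= 1 * \1_E x by rewrite cabs_wave mul1r.
apply: (le_lt_trans (cLnorm_le_indic mu p0 mE ler01 mw wE)).
rewrite mul1e pv /=; have fE : mu E \is a fin_num by rewrite ge0_fin_numE.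
by rewrite -(fineK fE) poweR_EFin ltry.
Qed.

Lemma inL_bounded_wave (p : \bar R) (b : Rn -> R[i]) (E : set Rn) (u : Rn)
    (M : R) :
  (0 < p)%E -> measurable E -> (mu E < +oo)%E -> cmeasurable setT b -> 0 <= M ->
  (forall x, E x -> cabs (b x) <= M) ->
  inL mu p (fun x => b x * wave E u x).
Proof.
move=> p0 mE Eoo mb M0 bM.
have mw := cmeasurableM mb (cmeasurable_wave u mE); split => //.
have [v v0 pv] := inve_fin p0.
have wE x : cabs (b x * wave E u x) <= M * \1_E x.
  rewrite cabsM cabs_wave indicE.
  have [Ex|Ex] := pselect (E x); first by rewrite mem_set// !mulr1 bM.
  by rewrite memNset// !mulr0.
apply: (le_lt_trans (cLnorm_le_indic mu p0 mE M0 mw wE)).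
rewrite pv /=; have fE : mu E \is a fin_num by rewrite ge0_fin_numE.
by rewrite -(fineK fE) poweR_EFin -EFinM ltry.
Qed.

(** A locally integrable [b] need not be locally in $L^p$, but multiplication by
    [b] preserves every $L^p$ on the set obtained here. *)
Lemma bounded_half_cube (b : Rn -> R[i]) (o : Rn) (l : R) :
  cmeasurable setT b -> 0 < l ->
  exists (N : nat) (E : set Rn), [/\ measurable E, E `<=` cube o l,
    (forall x, E x -> cabs (b x) <= N%:R) & ((l ^+ n / 2)%:E <= mu E)%E].
Proof.
move=> mb l0; have mQ : measurable (cube o l) by exact: measurable_cube.
have muQ : mu (cube o l) = (l ^+ n)%:E by apply: lebesgue_cube; exact: ltW.
have Qfin : (0 < mu (cube o l) < +oo)%E.
  by rewrite muQ lte_fin exprn_gt0// ltry.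
have [N [mE hN]] := mu_truncation mQ mb Qfin.
exists N, (cube o l `&` [set x | cabs (b x) <= N%:R]); split => //.
- by move=> x [].
- by rewrite EFinM -muQ; exact: hN.
Qed.

(** The form common to both commutators: [beta] is the symbol read in the
    variable of the argument that it multiplies, and only test functions that stay in the
    Lebesgue spaces after multiplication by [b] are used. *)
Lemma BMO_of_commutator (alpha : R) (p1 p2 q : \bar R)
    (b : Rn -> R[i]) (beta : Rn * Rn -> R[i])
    (comm : (Rn -> R[i]) -> (Rn -> R[i]) -> Rn -> R[i])
    (K : Rn * Rn -> R[i]) :
  (0 < n)%N -> (0 < p1)%E -> (0 < p2)%E -> (0 < q)%E -> (q^-1 < 1)%E ->
  (q^-1 = p1^-1 + p2^-1 - (alpha / n%:R)%:E)%E ->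
  loc_integrable b ->
  homogeneous (- (2 * n)%:R + alpha) K ->
  (exists (c : Rn * Rn) (r : R), 0 < r /\ inv_abs_fourier K (ball2 c r)) ->
  cmeasurable setT beta ->
  (forall y z, beta (y, z) = b y \/ beta (y, z) = b z) ->
  (forall f g, inL mu p1 f -> inL mu p2 g ->
    inL mu p1 (fun y => b y * f y) -> inL mu p2 (fun y => b y * g y) ->
    {ae mu, forall x, ~ (supp f `&` supp g) x ->
      let F := fun w : Rn * Rn => K (x - w.1, x - w.2) * f w.1 * g w.2 in
      [/\ cintegrable (mu \x mu)%E setT F,
          cintegrable (mu \x mu)%E setT (fun w => beta w * F w) &
          comm f g x = b x * cintegral (mu \x mu)%E setT F -
            cintegral (mu \x mu)%E setT (fun w => beta w * F w)]}) ->
  (exists C : R, forall f g, inL mu p1 f -> inL mu p2 g ->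
    inL mu p1 (fun y => b y * f y) -> inL mu p2 (fun y => b y * g y) ->
    inL mu q (comm f g) /\
    (cLnorm mu q (comm f g) <= C%:E * cLnorm mu p1 f * cLnorm mu p2 g)%E) ->
  BMO b.
Proof.
move=> n0 p10 p20 q0 q1 hexp hb hK [cB [r [r0 [a [nu [cva hW]]]]]] mbeta hbeta
  hcomm [C0 hC].
have [c [e [e0 hbox]]] := box_in_ball2 cB n0 r0.
have [u1 u10 pu1] := inve_fin p10; have [u2 u20 pu2] := inve_fin p20.
have [v v0 qv] := inve_fin q0.
have vE : v = u1 + u2 - alpha / n%:R.
  by move: hexp; rewrite qv pu1 pu2 => -[].
pose s := - (2 * n)%:R + alpha.
pose A := limn (series (fun k => cabs (a k))).
have hA N : \sum_(0 <= k < N) cabs (a k) <= A.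
  have nd : nondecreasing_seq (series (fun k => cabs (a k))).
    by apply: nondecreasing_series => k _ _; exact: cabs_ge0.
  exact: (nondecreasing_cvgn_le nd cva N).
have A0 : 0 <= A by have := hA 0%N; rewrite big_nil.
pose C := `|C0|; have Cge0 : 0 <= C by exact: normr_ge0.
(* The factor 4 pays for the halves lost in passing to [E1] and [E2]. *)
apply: (@BMO_of_oscillation _ _ _ (4 * A * C * e `^ s)) => // o l l0.
set V := l ^+ n; have V0 : 0 < V by rewrite exprn_gt0.
pose t := e / l; have t0 : 0 < t by rewrite divr_gt0.
pose Q := cube o l.
pose Q1 := cube (o - t^-1 *: c.1) l; pose Q2 := cube (o - t^-1 *: c.2) l.
have mQ : measurable Q by exact: measurable_cube.
have muQ' (o' : Rn) : mu (cube o' l) = V%:E by apply: lebesgue_cube; exact: ltW.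
have mb := hb.1.
have [N1 [E1 [mE1 E1Q bE1 VE1]]] := bounded_half_cube (o - t^-1 *: c.1) mb l0.
have [N2 [E2 [mE2 E2Q bE2 VE2]]] := bounded_half_cube (o - t^-1 *: c.2) mb l0.
have muE1 : (mu E1 <= V%:E)%E.
  by rewrite -(muQ' (o - t^-1 *: c.1)) le_measure ?inE//; exact: measurable_cube.
have muE2 : (mu E2 <= V%:E)%E.
  by rewrite -(muQ' (o - t^-1 *: c.2)) le_measure ?inE//; exact: measurable_cube.
have E1oo : (mu E1 < +oo)%E by rewrite (le_lt_trans muE1) ?ltry.
have E2oo : (mu E2 < +oo)%E by rewrite (le_lt_trans muE2) ?ltry.
have box x y (d : Rn) i : Q x -> cube (o - t^-1 *: d) l y ->
    `|(t *: (x - y)) ord0 i - d ord0 i| <= e.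
  move=> /(_ i) /andP[x1 x2] /(_ i); rewrite !mxE => /andP[y1 y2].
  have -> : t * (x ord0 i - y ord0 i) - d ord0 i =
     t * ((x ord0 i - o ord0 i) - (y ord0 i - (o ord0 i - t^-1 * d ord0 i))).
    by field; rewrite gt_eqF.
  have -> : e = t * l by rewrite /t divfK// gt_eqF.
  rewrite normrM gtr0_norm// ler_pM2l// ler_norml; apply/andP; split; lra.
have hW' x y z : Q x -> Q1 y -> Q2 z ->
    ball2 cB r (t *: (x - y), t *: (x - z)) /\
    (t *: (x - y), t *: (x - z)) != (0, 0).
  by move=> Qx Q1y Q2z; apply: hbox => i /=; exact: box.
pose f k := wave E1 (t *: (nu k).1); pose g k := wave E2 (t *: (nu k).2).
have fL k : inL mu p1 (f k) by exact: inL_wave.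
have gL k : inL mu p2 (g k) by exact: inL_wave.
have bfL k : inL mu p1 (fun y => b y * f k y).
  exact: (inL_bounded_wave _ p10 mE1 E1oo mb (ler0n _ N1)).
have bgL k : inL mu p2 (fun y => b y * g k y).
  exact: (inL_bounded_wave _ p20 mE2 E2oo mb (ler0n _ N2)).
pose D k := comm (f k) (g k).
(* A common point of the three cubes would put the origin in the box. *)
have supp_disj k x : Q x -> ~ (supp (f k) `&` supp (g k)) x.
  move=> Qx [fx gx].
  have Q1x : Q1 x.
    by apply: supp_sub_cube fx => y Q1y; apply: wave_out => /E1Q.
  have Q2x : Q2 x.
    by apply: supp_sub_cube gx => y Q2y; apply: wave_out => /E2Q.
  by have [_] := hW' _ _ _ Qx Q1x Q2x; rewrite subrr !scaler0 eqxx.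
pose m := fine (mu E1 * mu E2)%E.
have mV : V ^+ 2 / 4 <= m.
  have fE1 : mu E1 \is a fin_num by rewrite ge0_fin_numE.
  have fE2 : mu E2 \is a fin_num by rewrite ge0_fin_numE.
  have {}VE1 : V / 2 <= fine (mu E1) by rewrite -lee_fin fineK.
  have {}VE2 : V / 2 <= fine (mu E2) by rewrite -lee_fin fineK.
  rewrite /m fineM//; apply: (@le_trans _ _ ((V / 2) * (V / 2))); first by lra.
  by apply: ler_pM => //; rewrite divr_ge0// ltW.
have m0 : 0 < m by rewrite (lt_le_trans _ mV)// divr_gt0// exprn_gt0.
pose c0 := cintegral (mu \x mu)%E setT
  (fun w => beta w * (\1_(E1 `*` E2) w)%:C%C).
have pointwise : {ae mu, forall x, Q x ->
    ((m * cabs (b x - c0 / m%:C%C))%:E <=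
      \sum_(0 <= k <oo) (t `^ s * cabs (a k) * cabs (D k x))%:E)%E}.
  have := ae_foralln (fun k => hcomm _ _ (fL k) (gL k) (bfL k) (bgL k)).
  apply: filterS => x Hx Qx.
  have {}Hx k := Hx k (supp_disj k x Qx).
  have bnd y z : E1 y -> E2 z -> cabs (beta (y, z)) <= (N1 + N2)%:R.
    move=> E1y E2z; rewrite natrD; have [->|->] := hbeta y z.
      by rewrite (le_trans (bE1 _ E1y))// lerDl.
    by rewrite (le_trans (bE2 _ E2z))// lerDr.
  have inB y z : E1 y -> E2 z -> let w := (t *: (x - y), t *: (x - z)) in
      w != (0, 0) /\ K w != 0 /\
      (fun N => cabs (\sum_(0 <= k < N)
         a k * expi (dotr (nu k).1 w.1 + dotr (nu k).2 w.2) - (K w)^-1))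
        @ \oo --> (0 : R).
    move=> E1y E2z w; have [Bw w0] := hW' x y z Qx (E1Q _ E1y) (E2Q _ E2z).
    by split => //; exact: hW.
  have := oscillation_le_fourier (b x) hK t0 hA mE1 mE2 E1oo E2oo mbeta bnd inB.
  move=> /(_ (fun k => let: And3 i _ _ := Hx k in i)).
  move=> /(_ (fun k => let: And3 _ i _ := Hx k in i)) H.
  have -> : m * cabs (b x - c0 / m%:C%C) = cabs (b x * m%:C%C - c0).
    rewrite -[X in X * cabs _](gtr0_norm m0) -cabs_real -cabsM; congr cabs.
    rewrite mulrBr mulrC; congr (_ - _); rewrite mulrCA divff ?mulr1//.
    by rewrite eq_complex /= gt_eqF.
  apply: le_trans H _; apply: lee_nneseries.
    by move=> k _ _; rewrite lee_fin !mulr_ge0 ?powR_ge0 ?cabs_ge0.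
  by move=> k _; have [_ _ Dk] := Hx k; rewrite /D Dk.
exists (c0 / m%:C%C).
pose B := C * (V `^ u1 * V `^ u2 * V `^ (1 - v)).
(* Hoelder on [Q], then the norms of the waves; the truncation levels do not
   appear. *)
have hD k : (\int[mu]_(x in Q) (cabs (D k x))%:E <= B%:E)%E.
  have [[mDk _] hDk] := hC _ _ (fL k) (gL k) (bfL k) (bgL k).
  apply: (le_trans (integral_cabs_le_cLnorm mu q0 q1 mQ mDk)).
  have f1 : (cLnorm mu p1 (f k) <= (V `^ u1)%:E)%E.
    have wE x : cabs (f k x) <= 1 * \1_E1 x by rewrite cabs_wave mul1r.
    apply: (le_trans (cLnorm_le_indic mu p10 mE1 ler01 (fL k).1 wE)).
    by rewrite mul1e pu1 le_poweR_fin.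
  have g1 : (cLnorm mu p2 (g k) <= (V `^ u2)%:E)%E.
    have wE x : cabs (g k x) <= 1 * \1_E2 x by rewrite cabs_wave mul1r.
    apply: (le_trans (cLnorm_le_indic mu p20 mE2 ler01 (gL k).1 wE)).
    by rewrite mul1e pu2 le_poweR_fin.
  have Q1' : (mu Q `^ (1 - fine q^-1) <= (V `^ (1 - v))%:E)%E.
    by rewrite qv muQ' poweR_EFin.
  have D1 : (cLnorm mu q (D k) <= (C * V `^ u1 * V `^ u2)%:E)%E.
    apply: le_trans hDk _.
    apply: (@le_trans _ _ (C%:E * cLnorm mu p1 (f k) * cLnorm mu p2 (g k))%E).
      apply: lee_wpmul2r; first exact: Lnorm_ge0.
      by apply: lee_wpmul2r; [exact: Lnorm_ge0|rewrite lee_fin ler_norm].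
    rewrite !EFinM; apply: lee_pmul => //.
    - by apply: mule_ge0; [rewrite lee_fin|exact: Lnorm_ge0].
    - exact: Lnorm_ge0.
    - by apply: lee_wpmul2l; first rewrite lee_fin.
  apply: le_trans (lee_pmul _ _ D1 Q1') _ => //; first exact: Lnorm_ge0.
    exact: poweR_ge0.
  by rewrite -EFinM /B !mulrA.
have mD k : measurable_fun Q (fun x => (cabs (D k x))%:E).
  have [[mDk _] _] := hC _ _ (fL k) (gL k) (bfL k) (bgL k).
  exact: measurable_funS (measurable_cabsE mDk).
have total : (m%:E * \int[mu]_(x in Q) (cabs (b x - c0 / m%:C%C))%:E <=
    (t `^ s * A * B)%:E)%E.
  have mbc : measurable_fun Q (fun x => (cabs (b x - c0 / m%:C%C))%:E).
    have mbT := cmeasurableB mb (cmeasurable_cst setT (c0 / m%:C%C)).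
    exact: measurable_funS (measurable_cabsE mbT).
  have term_ge0 k x : (0 <= (t `^ s * cabs (a k) * cabs (D k x))%:E)%E.
    by rewrite lee_fin !mulr_ge0 ?powR_ge0 ?cabs_ge0.
  have mterm k :
      measurable_fun Q (fun x => (t `^ s * cabs (a k) * cabs (D k x))%:E).
    by under eq_fun do rewrite EFinM; exact: measurable_funeM.
  rewrite -ge0_integralZl_EFin//; last 2 first.
  - by move=> x _; rewrite lee_fin cabs_ge0.
  - exact: ltW.
  apply: (@le_trans _ _ (\int[mu]_(x in Q)
      \sum_(0 <= k <oo) (t `^ s * cabs (a k) * cabs (D k x))%:E)%E).
    apply: ae_ge0_le_integral => //.
    - by move=> x _; rewrite -EFinM lee_fin mulr_ge0 ?cabs_ge0// ltW.
    - exact: measurable_funeM.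
    - by move=> x _; exact: nneseries_ge0.
    - exact: (@ge0_emeasurable_sum _ _ _ _ _ predT).
  rewrite integral_nneseries//; apply: lime_le.
    by apply: is_cvg_nneseries => k _ _; exact: integral_ge0.
  apply: nearW => N.
  apply: (@le_trans _ _ (\sum_(0 <= k < N) (t `^ s * cabs (a k) * B)%:E)%E).
    apply: lee_sum => k _; under eq_integral do rewrite EFinM.
    rewrite ge0_integralZl_EFin// ?mulr_ge0 ?powR_ge0 ?cabs_ge0//; last first.
      by move=> x _; rewrite lee_fin cabs_ge0.
    rewrite [leRHS]EFinM; apply: lee_wpmul2l => //.
    by rewrite lee_fin mulr_ge0 ?powR_ge0 ?cabs_ge0.
  rewrite sumEFin lee_fin -mulr_suml -mulr_sumr ler_wpM2r//.
    by rewrite /B !mulr_ge0 ?powR_ge0.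
  by rewrite ler_wpM2l ?powR_ge0.
rewrite -(@lee_pmul2l _ m%:E)//; apply: le_trans total _.
rewrite -EFinM lee_fin /B.
have -> : t `^ s * A * (C * (V `^ u1 * V `^ u2 * V `^ (1 - v))) =
   A * C * (t `^ s * (V `^ u1 * V `^ u2 * V `^ (1 - v))) by ring.
rewrite (scaling_exponents n0 l0 e0 vE) -/V -/s.
have ACe : 0 <= A * C * e `^ s by rewrite !mulr_ge0 ?powR_ge0 ?normr_ge0.
have -> : A * C * (e `^ s * V ^+ 3) = (A * C * e `^ s) * V ^+ 3 by ring.
have -> : m * (4 * A * C * e `^ s * V) = (A * C * e `^ s) * (4 * m * V) by ring.
apply: ler_wpM2l => //; rewrite exprS mulrC ler_wpM2r ?(ltW V0)//; lra.
Qed.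

End commutator_to_BMO.

Lemma supp_mul (R : realType) (n : nat) (b f : 'rV[R]_n -> R[i]) :
  supp (fun y => b y * f y) `<=` supp f.
Proof.
by apply: closure_subset => x /=; apply: contraNN => /eqP ->; rewrite mulr0.
Qed.

Theorem theorem1p1 (R : realType) (n : nat) (alpha : R) (p1 p2 q : \bar R)
    (b : 'rV[R]_n -> R[i])
    (T : ('rV[R]_n -> R[i]) -> ('rV[R]_n -> R[i]) -> 'rV[R]_n -> R[i])
    (K : 'rV[R]_n * 'rV[R]_n -> R[i])
    (hn : (0 < n)%N)
    (hp1 : (0 < p1)%E) (hp2 : (0 < p2)%E) (hq : (0 < q)%E)
    (hq1 : (q^-1 < 1)%E)
    (hexp : (q^-1 = p1^-1 + p2^-1 - (alpha / n%:R)%:E)%E)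
    (hb : loc_integrable b)
    (hT : bilinear_operator p1 p2 T)
    (hK : homogeneous (- (2 * n)%:R + alpha) K)
    (hrep : represented_by p1 p2 T K)
    (hB : exists (c : 'rV[R]_n * 'rV[R]_n) (r : R),
        0 < r /\ inv_abs_fourier K (ball2 c r)) :
  (commutator1_bounded b T p1 p2 q -> BMO b) /\
  (commutator2_bounded b T p1 p2 q -> BMO b).
Proof.
split=> -[C hC].
- pose beta (w : 'rV[R]_n * 'rV[R]_n) := b w.1.
  apply: (@BMO_of_commutator _ _ alpha p1 p2 q b beta (commutator1 b T) K) => //.
  + exact: cmeasurable_comp measurable_fst hb.1.
  + by move=> y z; left.
  + move=> f g fL gL bfL _.
    apply: filterS2 (hrep _ _ fL gL) (hrep _ _ bfL gL) => x H1 H2 xfg.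
    have [iF TF] := H1 xfg.
    have {H2} := H2 (fun h => xfg (conj (supp_mul h.1) h.2)).
    move=> /=.
    rewrite (_ : (fun w => _ * (b w.1 * f w.1) * _) = (fun w =>
      beta w * (K (x - w.1, x - w.2) * f w.1 * g w.2))); last first.
      by apply/funext => w; rewrite /beta; ring.
    by move=> [ibF TbF]; split=> //; rewrite /commutator1 TF TbF.
  + by exists C => f g fL gL bfL _; exact: hC.
- pose beta (w : 'rV[R]_n * 'rV[R]_n) := b w.2.
  apply: (@BMO_of_commutator _ _ alpha p1 p2 q b beta (commutator2 b T) K) => //.
  + exact: cmeasurable_comp measurable_snd hb.1.
  + by move=> y z; right.
  + move=> f g fL gL _ bgL.
    apply: filterS2 (hrep _ _ fL gL) (hrep _ _ fL bgL) => x H1 H2 xfg.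
    have [iF TF] := H1 xfg.
    have {H2} := H2 (fun h => xfg (conj h.1 (supp_mul h.2))).
    move=> /=.
    rewrite (_ : (fun w => _ * _ * (b w.2 * g w.2)) = (fun w =>
      beta w * (K (x - w.1, x - w.2) * f w.1 * g w.2))); last first.
      by apply/funext => w; rewrite /beta; ring.
    by move=> [ibF TbF]; split=> //; rewrite /commutator2 TF TbF.
  + by exists C => f g fL gL _ bgL; exact: hC.
Qed.
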